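(* Let $n,k$ be positive integers. If $a_1,a_2,\dots,a_k\in\mathbb{Z}^+$ (not necessarily distinct), then $$\left|\bigoplus_{i=1}^k \{a_i,2a_i,\dots,na_i\}\right|\geq n.$$
   Context: $\mathbb{Z}^+$ denotes the set of positive integers. For finite sets $A,B\subseteq\mathbb{Z}$, $A\oplus B$ denotes the set of those integers that can be represented as $a+b$ with $a\in A$, $b\in B$ in an odd number of ways (i.e. for an odd number of pairs $(a,b)\in A\times B$). This operation is associative and commutative, and $\bigoplus_{i=1}^k S_i = S_1\oplus S_2\oplus\dots\oplus S_k$ denotes the iterated operation; equivalently, it is the set of integers $m$ for which the number of tuples $(s_1,\dots,s_k)\in S_1\times\dots\times S_k$ with $s_1+\dots+s_k=m$ is odd. For $k=1$ it is just $S_1$. *)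

(* Defs.v *)
From HB Require Import structures.
From mathcomp Require Import all_boot all_order all_algebra.
From mathcomp Require Import finmap.

Set Implicit Arguments.
Unset Strict Implicit.
Unset Printing Implicit Defensive.

Import Order.TTheory GRing.Theory Num.Theory.
Local Open Scope fset_scope.
Local Open Scope ring_scope.

Definition sum_pairs (A B : {fset int}) (m : int) : {fset int * int} :=
  [fset p in A `*` B | p.1 + p.2 == m].

(* The image set only bounds the comprehension: see mem_oddsum. *)
Definition oddsum (A B : {fset int}) : {fset int} :=
  [fset m in [fset a + b | a in A, b in B] | odd #|` sum_pairs A B m|].

Lemma mem_oddsum (A B : {fset int}) (m : int) :
  (m \in oddsum A B) = odd #|` sum_pairs A B m|.
Proof.
rewrite !inE /=; case: (boolP (odd _)) => [oddm|_]; last by rewrite andbF.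
rewrite andbT; have: sum_pairs A B m != fset0.
  by apply: contraL oddm => /eqP ->; rewrite cardfs0.
case/fset0Pn=> -[a b]; rewrite !inE /= => /andP[/andP[aA bB] /eqP <-].
by apply/imfset2P; exists a => //; exists b.
Qed.

Lemma mem_oddsumE (A B : {fset int}) (m : int) :
  (m \in oddsum A B) = \big[addb/false]_(a <- A) (m - a \in B).
Proof.
rewrite mem_oddsum; have -> : sum_pairs A B m =
    [fset (a, m - a) | a in [fset a in A | m - a \in B]].
  apply/fsetP => -[a b]; rewrite !inE /=; apply/idP/imfsetP => /=.
    case/andP=> /andP[aA bB] /eqP <-; exists a; rewrite ?inE /= addrC addKr //.
    by rewrite aA.
  case=> x; rewrite !inE /= => /andP[xA xB] [-> ->].
  by rewrite xA xB addrC subrK eqxx.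
rewrite card_imfset /=; last by move=> x y [].
rewrite card_fset_sum1 -big_fset_condE big_mkcond /=.
rewrite (big_morph odd oddD (erefl _)); apply: eq_bigr => a _.
by case: ifP.
Qed.

Lemma oddsumC : commutative oddsum.
Proof.
move=> A B; apply/fsetP => m; rewrite !mem_oddsum; congr odd.
have -> : sum_pairs B A m = [fset (p.2, p.1) | p in sum_pairs A B m].
  apply/fsetP => -[b a]; rewrite !inE /=; apply/idP/imfsetP => /=.
    case/andP=> /andP[bB aA] /eqP <-; exists (a, b) => //.
    by rewrite !inE /= aA bB addrC eqxx.
  case=> -[x y]; rewrite !inE /= => /andP[/andP[xA yB] /eqP <-] [-> ->].
  by rewrite xA yB addrC eqxx.
by rewrite [in RHS]card_imfset //= => -[x y] [z t] [-> ->].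
Qed.

Lemma oddsumA : associative oddsum.
Proof.
move=> A B C; rewrite [RHS]oddsumC (oddsumC B).
apply/fsetP => m; rewrite !mem_oddsumE.
under eq_bigr do rewrite mem_oddsumE.
under [RHS]eq_bigr do rewrite mem_oddsumE.
rewrite exchange_big /=; apply: eq_bigr => c _; apply: eq_bigr => a _.
by rewrite addrAC.
Qed.

Lemma oddsum0s : left_id [fset 0] oddsum.
Proof. by move=> A; apply/fsetP=> m; rewrite mem_oddsumE big_seq_fset1 subr0. Qed.

(* The neutral element {0} of oddsum is what \big[oddsum/[fset 0]] starts from;
   it leaves the iterated operation over a nonempty index range unchanged. *)
HB.instance Definition _ :=
  Monoid.isComLaw.Build {fset int} [fset 0] oddsum oddsumA oddsumC oddsum0s.

Definition multiples (n : nat) (a : int) : {fset int} :=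
  [fset j%:Z * a | j in iota 1 n].

(* Main.v *)
Require Import Defs.
From mathcomp Require Import all_boot all_order all_algebra.
From mathcomp Require Import finmap.
From mathcomp Require Import zify.

(** A finite set of nonnegative integers is the support of a polynomial over
    the field with two elements, and the operation [oddsum] is then the product
    of polynomials.  So the claim is a lower bound for the number of nonzero
    coefficients (the weight) of the product G of the polynomials
    X^a (1 + X^a + ... + X^((n-1) a)), where a runs over the a_i.

    Dividing all the a_i by their gcd replaces G(X^d) by G(X), with the same
    weight, so let the a_i have gcd 1.  Write n = 2^m q and a_i = 2^(v_i) b_i
    with q and the b_i odd.  In characteristic 2 the identity
    X^(na) - 1 = (X^(qb) - 1)^(2^(v+m)) gives ([geo_factor])

      G = A(X^q) Q(X),  A(Y) = (Y - 1)^(s (2^m - 1)) U(Y),  s > 0, U(1) <> 0,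

    where Q is the product of the X^a (1 + X^b + ... + X^((q-1) b))^(2^v).
    The coefficients of Q modulo X^q - 1 are indexed by Z/q and are invariant
    under translation by every a_i, since (X^a - 1) Q is a multiple of X^q - 1;
    as the a_i have gcd 1, they are all equal.  They add up to Q(1), which is
    1, so none of them vanishes.

    Sort now the monomials of G by the residue r of their exponent modulo q.
    The part of residue r is X^r (A Q_r)(X^q), where Q_r(1) is the r-th
    coefficient of Q modulo X^q - 1, so that A Q_r has at 1 a zero of order
    exactly s (2^m - 1).  In characteristic 2, a polynomial with a zero of order
    exactly e at 1 has at least 2^(digit sum of e in base 2) nonzero
    coefficients ([weight_multiplicity]), and every positive multiple of
    2^m - 1 has binary digit sum at least m ([digit_sum_mul_Mersenne]).  Each of
    the q residues thus contributes at least 2^m monomials, which makes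
    2^m q = n in all. *)

Set Implicit Arguments.
Unset Strict Implicit.
Unset Printing Implicit Defensive.

Import Order.TTheory GRing.Theory Num.Theory.
Local Open Scope ring_scope.

(** * Periods and binary digit sums *)

Lemma period_gcd (T : Type) (f : nat -> T) a b :
  (forall r, f (r + a)%N = f r) -> (forall r, f (r + b)%N = f r) ->
  forall r, f (r + gcdn a b)%N = f r.
Proof.
move=> fa fb r; have [->|a_gt0] := posnP a; first by rewrite gcd0n.
have periodM c : (forall s, f (s + c)%N = f s) ->
    forall t s, f (s + t * c)%N = f s.
  by move=> fc; elim=> [|t IHt] s; rewrite ?addn0 // mulSn addnA IHt.
case: (egcdnP b a_gt0) => ka kb eqg _.
by rewrite -(periodM b fb kb) -addnA [X in (_ + X)%N]addnC -eqg periodM.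
Qed.

(** Only the [k] lowest digits are read: [k] makes the recursion structural,
    and any [k >= e] reads them all. *)
Fixpoint digit_sum_upto (k e : nat) : nat :=
  if k is k'.+1 then (odd e + digit_sum_upto k' e./2)%N else 0%N.

Definition digit_sum (e : nat) : nat := digit_sum_upto e e.

Lemma digit_sum_upto_eq k l e :
  (e <= k)%N -> (e <= l)%N -> digit_sum_upto k e = digit_sum_upto l e.
Proof.
elim: k l e => [|k IHk] [|l] e //=.
- by rewrite leqn0 => /eqP -> _; elim: l.
- by move=> _; rewrite leqn0 => /eqP ->; elim: k {IHk}.
by move=> le_ek le_el; rewrite (IHk l) //; lia.
Qed.

Lemma digit_sumE e : digit_sum e = (odd e + digit_sum e./2)%N.
Proof.
case: e => [|e] //; rewrite {1}/digit_sum [LHS]/=; congr (_ + _)%N.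
by apply: digit_sum_upto_eq; lia.
Qed.

(** Every carry in a binary addition replaces two digits 1 by a single one in
    the next place. *)
Lemma digit_sumD a b : (digit_sum (a + b) <= digit_sum a + digit_sum b)%N.
Proof.
have [s] := ubnP (a + b); elim: s a b => // s IHs a b lt_s.
have [/eqP|ab_gt0] := posnP (a + b).
  by rewrite addn_eq0 => /andP[/eqP-> /eqP->].
rewrite (digit_sumE (a + b)) (digit_sumE a) (digit_sumE b) oddD halfD.
have IH := IHs a./2 b./2 ltac:(lia).
set h := (a./2 + b./2)%N in IH *.
set x := digit_sum a./2 in IH *; set y := digit_sum b./2 in IH *.
case: (boolP (odd a)) => oa; case: (boolP (odd b)) => ob /=;
  rewrite ?add0n; try by clearbody h x y; lia.
(* Two odd numbers: the lowest digits 1 and 1 become a carry 1. *)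
have {IHs} := IHs 1%N (a./2 + b./2)%N ltac:(lia).
rewrite -/h; have d1 : digit_sum 1 = 1%N by [].
by clearbody h x y; rewrite d1; lia.
Qed.

Lemma digit_sum_shift m A B : (B < 2 ^ m)%N ->
  digit_sum (A * 2 ^ m + B) = (digit_sum A + digit_sum B)%N.
Proof.
elim: m A B => [|m IHm] A B.
  rewrite expn0 muln1 ltnS leqn0 => /eqP->.
  by rewrite addn0 [digit_sum 0]/= addn0.
rewrite expnS => ltB; rewrite digit_sumE (digit_sumE B).
have -> : (A * (2 * 2 ^ m) + B = (A * 2 ^ m).*2 + B)%N by lia.
rewrite halfD odd_double /= doubleK oddD odd_double IHm //; lia.
Qed.

Lemma digit_sum_Mersenne m : digit_sum (2 ^ m).-1 = m.
Proof.
elim: m => // m IHm; rewrite digit_sumE -[in RHS]IHm expnS.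
have : (0 < 2 ^ m)%N by rewrite expn_gt0.
case: (2 ^ m)%N => // k _.
have -> : (2 * k.+1).-1 = k.*2.+1 by lia.
by rewrite /= odd_double /= uphalf_double.
Qed.

(** Cut a multiple of [2 ^ m - 1] exceeding it into its [m] lowest digits [B]
    and the remaining digits [A].  Since [2 ^ m] is 1 modulo [2 ^ m - 1], the
    number [A + B] is again a multiple, it is smaller and positive, and its
    digit sum is no larger. *)
Lemma digit_sum_mul_Mersenne m s :
  (0 < s)%N -> (m <= digit_sum (s * (2 ^ m).-1))%N.
Proof.
have M_gt0 : (0 < 2 ^ m)%N by rewrite expn_gt0.
have [t] := ubnP s; elim: t s => // t IHt s lt_st s_gt0.
have [le_s1|lt_s1] := leqP (s * (2 ^ m).-1) (2 ^ m).-1.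
  have [m0|m_gt0] := posnP m; first by rewrite m0.
  have M_gt1 : (1 < 2 ^ m)%N by rewrite -(expn0 2) ltn_exp2l.
  have -> : s = 1%N by nia.
  by rewrite mul1n digit_sum_Mersenne.
set e := (s * _)%N; set A := (e %/ 2 ^ m)%N; set B := (e %% 2 ^ m)%N.
have eE : e = (A * 2 ^ m + B)%N by rewrite -divn_eq.
have A_gt0 : (0 < A)%N by rewrite divn_gt0 // /e; lia.
have ABE : (A + B = (s - A) * (2 ^ m).-1)%N.
  by rewrite mulnBl -/e eE; nia.
rewrite eE digit_sum_shift ?ltn_mod //.
apply: leq_trans (digit_sumD A B); rewrite ABE; apply: IHt; first lia.
by case: (posnP (s - A)) => // sA0; move: ABE; rewrite sA0; lia.
Qed.

(** * Splitting a polynomial by the residues of the exponents *)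

Section ResidueSections.

Variable R : comNzRingType.
Implicit Types (p A B : {poly R}) (q r : nat).

Definition weight p : nat := (\sum_(i < size p) (p`_i != 0)%R)%N.

(** The polynomials p_r such that p is the sum over r < q of X^r p_r(X^q). *)
Definition residue_section q r p : {poly R} :=
  \poly_(j < size p) p`_(j * q + r).

(** The coefficient of [p] modulo X^q - 1 at X^r, as a [q]-periodic function
    of [r]. *)
Definition residue_sum q p r : R := (residue_section q (r %% q) p).[1].

Lemma coef_section q r p j : (0 < q)%N ->
  (residue_section q r p)`_j = p`_(j * q + r).
Proof.
move=> q_gt0; rewrite coef_poly; case: ltnP => // le_pj.
rewrite nth_default // (leq_trans le_pj) //.
exact: leq_trans (leq_pmulr j q_gt0) (leq_addr _ _).
Qed.

Lemma sectionD q r p1 p2 : (0 < q)%N ->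
  residue_section q r (p1 + p2) =
  residue_section q r p1 + residue_section q r p2.
Proof.
by move=> q_gt0; apply/polyP=> j; rewrite coefD !coef_section // coefD.
Qed.

Lemma sectionCM q r c p : (0 < q)%N ->
  residue_section q r (c%:P * p) = c%:P * residue_section q r p.
Proof.
by move=> q_gt0; apply/polyP=> j; rewrite coefCM !coef_section // coefCM.
Qed.

Lemma sectionXnM q r p : (r < q)%N ->
  residue_section q r ('X^q * p) = 'X * residue_section q r p.
Proof.
move=> lt_rq; have q_gt0 : (0 < q)%N by lia.
apply/polyP=> j; rewrite coefXM !coef_section // coefXnM.
case: j => [|j]; first by rewrite mul0n add0n lt_rq.
by rewrite ifF /=; [congr (_`__); lia | lia].
Qed.

(** Multiplying by a power of X^q does not mix residues modulo [q], so taking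
    the part of residue [r] is linear over the polynomials in X^q. *)
Lemma section_comp_mul q r A B : (r < q)%N ->
  residue_section q r ((A \Po 'X^q) * B) = A * residue_section q r B.
Proof.
move=> lt_rq; have q_gt0 : (0 < q)%N by lia.
elim/poly_ind: A B => [|A c IHA] B.
  rewrite comp_poly0 !mul0r; apply/polyP=> j.
  by rewrite coef_section // !coef0.
rewrite comp_polyD comp_polyM comp_polyX comp_polyC !mulrDl sectionD //.
by rewrite sectionCM // -!mulrA IHA sectionXnM.
Qed.

Lemma big_by_residue (T : Type) (idx : T) (op : Monoid.com_law idx)
    (F : nat -> T) N q :
  \big[op/idx]_(i < N * q) F i =
  \big[op/idx]_(r < q) \big[op/idx]_(j < N) F (j * q + r)%N.
Proof.
rewrite -(big_mkord xpredT F) big_nat_mul big_mkord exchange_big /=.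
apply: eq_bigr => j _; rewrite -{1}[(j * q)%N]add0n big_addn.
have -> : (j.+1 * q - j * q = q)%N by rewrite mulSn addnK.
by rewrite big_mkord; apply: eq_bigr => r _; rewrite addnC.
Qed.

Lemma weight_wide N p : (size p <= N)%N ->
  weight p = (\sum_(i < N) (p`_i != 0)%R)%N.
Proof.
move=> le_pN.
rewrite /weight (big_ord_widen N (fun i => nat_of_bool (p`_i != 0))) //.
rewrite big_mkcond /=; apply: eq_bigr => i _.
by case: ltnP => // le_pi; rewrite nth_default // eqxx.
Qed.

Lemma size_section q r p : (size (residue_section q r p) <= size p)%N.
Proof. exact: size_poly. Qed.

Lemma weight_sections q p : (0 < q)%N ->
  weight p = (\sum_(r < q) weight (residue_section q r p))%N.
Proof.
move=> q_gt0; rewrite (@weight_wide (size p * q)) ?leq_pmulr //.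
rewrite (big_by_residue _ (fun i => nat_of_bool (p`_i != 0))).
apply: eq_bigr => r _; rewrite (weight_wide (size_section q r p)).
by apply: eq_bigr => j _; rewrite coef_section.
Qed.

Lemma residue_sumE q p r : (0 < q)%N ->
  residue_sum q p r = \sum_(j < size p) p`_(j * q + r %% q).
Proof.
move=> q_gt0; rewrite /residue_sum (horner_coef_wide _ (size_section _ _ _)).
by apply: eq_bigr => j _; rewrite expr1n mulr1 coef_section.
Qed.

Lemma horner1_residues q p : (0 < q)%N ->
  p.[1] = \sum_(r < q) residue_sum q p r.
Proof.
move=> q_gt0; rewrite (@horner_coef_wide _ (size p * q)) ?leq_pmulr //.
under eq_bigr do rewrite expr1n mulr1.
rewrite (big_by_residue _ (fun i => p`_i)); apply: eq_bigr => r _.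
by rewrite residue_sumE // modn_small.
Qed.

Lemma residue_sumD q p1 p2 r : (0 < q)%N ->
  residue_sum q (p1 + p2) r = residue_sum q p1 r + residue_sum q p2 r.
Proof. by move=> q_gt0; rewrite /residue_sum sectionD // hornerD. Qed.

(** In particular multiples of X^q - 1 have zero residue sums. *)
Lemma residue_sum_comp_mul q A B r : (0 < q)%N ->
  residue_sum q ((A \Po 'X^q) * B) r = A.[1] * residue_sum q B r.
Proof.
by move=> q_gt0; rewrite /residue_sum section_comp_mul ?ltn_mod // hornerM.
Qed.

Lemma residue_sumXM q p r : (0 < q)%N ->
  residue_sum q ('X * p) r.+1 = residue_sum q p r.
Proof.
move=> q_gt0; rewrite /residue_sum -addn1 -modnDml addn1.
have: (r %% q < q)%N by rewrite ltn_mod.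
move: (r %% q)%N => {}r lt_rq; have [eq_rq|ne_rq] := eqVneq r.+1 q.
  (* The exponent wraps around from q - 1 to 0: a factor X comes out. *)
  rewrite eq_rq modnn; transitivity ('X * residue_section q r p).[1].
    congr (_.[_]); apply/polyP=> j; rewrite coefXM !coef_section // coefXM.
    case: j => [|j]; first by rewrite mul0n.
    by rewrite ifF /=; [congr (_`__); lia | lia].
  by rewrite hornerM hornerX mul1r.
rewrite modn_small; last by lia.
congr (_.[_]); apply/polyP=> j; rewrite !coef_section // coefXM.
by rewrite addnS.
Qed.

Lemma residue_sumXnM q p b r : (0 < q)%N ->
  residue_sum q ('X^b * p) (r + b) = residue_sum q p r.
Proof.
move=> q_gt0; elim: b => [|b IHb]; first by rewrite mul1r addn0.
by rewrite exprS -mulrA addnS residue_sumXM.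
Qed.

Lemma weight_comp_Xn d p : (0 < d)%N -> (weight p <= weight (p \Po 'X^d))%N.
Proof.
move=> d_gt0; rewrite [leqRHS](weight_sections _ d_gt0).
rewrite (bigD1 (Ordinal d_gt0)) //=.
suff -> : residue_section d 0 (p \Po 'X^d) = p by rewrite leq_addr.
apply/polyP=> j; rewrite coef_section // addn0 coef_comp_poly_Xn //.
by rewrite dvdn_mull // mulnK.
Qed.

End ResidueSections.

(** * Geometric sums *)

Section GeometricSums.

Variable R : comNzRingType.

Definition geo n a : {poly R} := \sum_(j < n) 'X^(j * a).

Lemma geoM n a : ('X^a - 1) * geo n a = 'X^(n * a) - 1.
Proof.
rewrite mulnC exprM [RHS]subrX1; congr (_ * _).
by apply: eq_bigr => j _; rewrite -exprM mulnC.
Qed.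

Lemma geo1M n : ('X - 1) * geo n 1 = 'X^n - 1.
Proof. by have := geoM n 1; rewrite expr1 muln1. Qed.

Lemma geo_comp_Xn n a d : geo n a \Po 'X^d = geo n (d * a).
Proof.
rewrite rmorph_sum; apply: eq_bigr => j _ /=.
by rewrite rmorphXn /= comp_polyX -exprM mulnCA.
Qed.

Lemma Xn_sub1_comp_Xn n d : ('X^n - 1 : {poly R}) \Po 'X^d = 'X^(d * n) - 1.
Proof. by rewrite rmorphB /= rmorph1 rmorphXn /= comp_polyX -exprM. Qed.

Lemma horner1_geo n a : (geo n a).[1] = n%:R.
Proof.
rewrite horner_sum; under eq_bigr do rewrite hornerXn expr1n.
by rewrite sumr_const card_ord.
Qed.

Lemma Xn_sub1_neq0 n : (0 < n)%N -> 'X^n - 1 != 0 :> {poly R}.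
Proof.
by move=> n_gt0; rewrite -lead_coef_eq0 lead_coefXnsubC // oner_neq0.
Qed.

Definition geo_prod k (a : 'I_k -> nat) n : {poly R} :=
  \prod_(i < k) ('X^(a i) * geo n (a i)).

End GeometricSums.

Arguments geo {R} n a.
Arguments geo_prod {R k} a n.

(** * Weights in characteristic two *)

Section CharTwo.

Variable R : idomainType.
Hypothesis charR : 2 \in [pchar R].
Implicit Types (p Q : {poly R}).

Let char_poly2 : 2 \in [pchar {poly R}].
Proof. by rewrite pchar_poly. Qed.

Lemma Frobenius_sub (x y : {poly R}) m :
  (x - y) ^+ (2 ^ m) = x ^+ (2 ^ m) - y ^+ (2 ^ m).
Proof.
rewrite !(GRing.subr_pchar2 char_poly2) exprDn_pchar //.
by rewrite (eq_pnat _ (pcharf_eq char_poly2)) pnatX.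
Qed.

Lemma weight_gt0 p : p != 0 -> (0 < weight p)%N.
Proof.
move=> p_neq0; rewrite /weight -(prednK (_ : 0 < size p)%N) ?size_poly_gt0 //.
by rewrite big_ord_recr /= -/(lead_coef p) lead_coef_eq0 p_neq0 addn1.
Qed.

(** Halve [e]: (X - 1)^e is (X^2 - 1)^(e/2), a polynomial in X^2, times [T],
    which is [Q] if [e] is even and (X - 1) [Q] if [e] is odd.  The even and odd
    parts of the product are (X - 1)^(e/2) times those of [T].  For even [e] the
    values at 1 of the parts of [T] add up to [Q.[1]], so one of them is
    nonzero; for odd [e] both are equal to [Q.[1]], and the bound doubles. *)
Lemma weight_multiplicity e Q :
  Q.[1] != 0 -> (2 ^ digit_sum e <= weight (('X - 1) ^+ e * Q))%N.
Proof.
have [s] := ubnP e; elim: s e Q => // s IHs e Q lt_es Q1.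
have [-> | e_gt0] := posnP e.
  rewrite mul1r; apply: weight_gt0; apply: contraNneq Q1 => ->.
  by rewrite horner0.
have lt_half : (e./2 < s)%N by lia.
have two_gt0 : (0 < 2)%N by [].
set T := ('X - 1) ^+ odd e * Q.
have -> : ('X - 1) ^+ e * Q = ((('X - 1) ^+ e./2) \Po 'X^2) * T.
  rewrite rmorphXn rmorphB /= comp_polyX rmorph1 -[1 in RHS](expr1n _ 2).
  rewrite -(Frobenius_sub 'X 1 1) -exprM mulrA -exprD.
  by congr (_ ^+ _ * _); lia.
rewrite (weight_sections _ two_gt0) !big_ord_recl big_ord0 addn0 /=.
rewrite !section_comp_mul // digit_sumE.
have TE r : (r < 2)%N -> (residue_section 2 r T).[1] = residue_sum 2 T r.
  by move=> lt_r2; rewrite /residue_sum modn_small.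
have := TE 0%N isT; have := TE 1%N isT; rewrite /bump /= => T1 T0.
case: (boolP (odd e)) => odd_e.
  have Q2 : Q.[1] = residue_sum 2 Q 0 + residue_sum 2 Q 1.
    by rewrite (horner1_residues _ two_gt0) !big_ord_recl big_ord0 addr0.
  have TQ r : residue_sum 2 T r.+1 = Q.[1].
    have -> : T = 'X * Q + 1%:P * Q.
      by rewrite /T odd_e expr1 (GRing.subr_pchar2 char_poly2) mulrDl.
    rewrite residue_sumD // residue_sumXM // mul1r Q2.
    by rewrite /residue_sum !modn2 /=; case: (odd r) => //=; rewrite addrC.
  rewrite expnD expn1 mul2n -addnn leq_add ?IHs // ?T1 ?T0 ?TQ //.
  have -> : residue_sum 2 T 0 = residue_sum 2 T 2 by [].
  by rewrite TQ.
have Q2 : Q.[1] = residue_sum 2 T 0 + residue_sum 2 T 1.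
  have -> : T = Q by rewrite /T (negbTE odd_e) mul1r.
  by rewrite (horner1_residues _ two_gt0) !big_ord_recl big_ord0 addr0.
rewrite add0n.
have [T0_0|T0_neq0] := eqVneq (residue_sum 2 T 0) 0.
  rewrite (leq_trans (IHs _ (residue_section 2 1 T) _ _)) ?leq_addl //.
  by rewrite T1; move: Q1; rewrite Q2 T0_0 add0r.
by rewrite (leq_trans (IHs _ (residue_section 2 0 T) _ _)) ?leq_addr // T0.
Qed.


(** After multiplication by X^a - 1, with a = 2^v b, both sides are the power
    of X^(qb) - 1 with exponent 2^(v+m): on the right,
    2^v + 2^v (2^m - 1) = 2^(v+m) factors are collected. *)
Lemma geo_factor m q v b : (0 < b)%N ->
  geo (2 ^ m * q) (2 ^ v * b) =
  geo q b ^+ (2 ^ v) *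
  ((('X - 1) * geo b 1) ^+ (2 ^ v * (2 ^ m).-1) \Po 'X^q) :> {poly R}.
Proof.
move=> b_gt0; have ab_gt0 : (0 < 2 ^ v * b)%N by rewrite muln_gt0 expn_gt0.
apply: (mulfI (Xn_sub1_neq0 R ab_gt0)); rewrite geoM geo1M.
rewrite rmorphXn /= Xn_sub1_comp_Xn.
have XE c e : 'X^(c * 2 ^ e) - 1 = ('X^c - 1) ^+ (2 ^ e) :> {poly R}.
  by rewrite Frobenius_sub expr1n -exprM.
rewrite [(2 ^ v * b)%N]mulnC XE mulrA -exprMn geoM -exprD.
have -> : (2 ^ m * q * (b * 2 ^ v) = (q * b) * 2 ^ (v + m))%N.
  by rewrite expnD; lia.
rewrite XE; congr (_ ^+ _).
by rewrite expnD -[X in (_ * X = _)%N]prednK ?expn_gt0 // mulnS.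
Qed.

Lemma natr_odd_neq0 n : odd n -> n%:R != 0 :> R.
Proof. by move=> odd_n; rewrite -(dvdn_pcharf charR) dvdn2 odd_n. Qed.

(** The core of the argument: the product is A(X^q) Q, where A has a zero of
    order e (2^m - 1) at 1 and Q has the same nonzero coefficient at each
    residue modulo X^q - 1. *)
Lemma weight_geo_prod_coprime k (a : 'I_k -> nat) n :
  (0 < n)%N -> (0 < k)%N -> (forall i, 0 < a i)%N ->
  \big[gcdn/0%N]_(i < k) a i = 1%N -> (n <= weight (geo_prod a n : {poly R}))%N.
Proof.
move=> n_gt0 k_gt0 a_gt0 gcd_a.
have oddP x : (0 < x)%N -> exists w b, odd b /\ x = (2 ^ w * b)%N.
  move=> x_gt0; exists (logn 2 x), (x`_2^')%N.
  by rewrite odd_2'nat part_pnat -p_part partnC.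
have [m [q [odd_q nE]]] := oddP _ n_gt0.
have {oddP} /fin_all_exists[v /fin_all_exists[b vbP]] :
    forall i, exists w b, odd b /\ a i = (2 ^ w * b)%N by move=> i; apply: oddP.
have odd_b i : odd (b i) by case: (vbP i).
have aE i : a i = (2 ^ v i * b i)%N by case: (vbP i).
have b_gt0 i : (0 < b i)%N by case: (b i) (odd_b i).
have q_gt0 : (0 < q)%N by case: q odd_q {nE}.
set Q : {poly R} := \prod_(i < k) ('X^(a i) * geo q (b i) ^+ (2 ^ v i)).
set U : {poly R} := \prod_(i < k) (geo (b i) 1) ^+ (2 ^ v i * (2 ^ m).-1).
set e := (\sum_(i < k) 2 ^ v i)%N.
have -> : geo_prod a n = ((('X - 1) ^+ (e * (2 ^ m).-1) * U) \Po 'X^q) * Q.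
  rewrite big_distrl /= -prodrXr -big_split rmorph_prod -big_split /=.
  apply: eq_bigr => i _; rewrite [in geo _ _]aE nE geo_factor //.
  by rewrite -exprMn mulrA mulrC.
have Q1 : Q.[1] != 0.
  rewrite horner_prod; apply/prodf_neq0 => i _.
  by rewrite hornerM hornerXn expr1n mul1r horner_exp horner1_geo
     expf_neq0 // natr_odd_neq0.
have U1 : U.[1] != 0.
  rewrite horner_prod; apply/prodf_neq0 => i _.
  by rewrite horner_exp horner1_geo expf_neq0 // natr_odd_neq0.
(* The difference X^(a i) * Q - Q is a multiple of X^q - 1, because the factor
   of Q at i turns into a power of X^(q * b i) - 1. *)
have period_a i r : residue_sum q Q (r + a i) = residue_sum q Q r.
  rewrite -[RHS](residue_sumXnM Q (a i)) //.
  have -> : 'X^(a i) * Q = Q + (('X^(b i) - 1) ^+ (2 ^ v i) \Po 'X^q) *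
      ('X^(a i) * \prod_(j < k | j != i) ('X^(a j) * geo q (b j) ^+ (2 ^ v j))).
    apply/eqP; rewrite addrC -subr_eq -{2}[Q]mul1r -mulrBl; apply/eqP.
    rewrite /Q (bigD1 i) //= rmorphXn /= Xn_sub1_comp_Xn -geoM exprMn.
    rewrite Frobenius_sub expr1n -exprM [(b i * _)%N]mulnC -aE.
    by rewrite -!mulrA; congr (_ * _); rewrite mulrCA.
  rewrite residue_sumD // residue_sum_comp_mul // horner_exp hornerD hornerN.
  by rewrite hornerXn hornerC expr1n subrr expr0n expn_eq0 /= mul0r addr0.
have period1 r : residue_sum q Q (r + 1) = residue_sum q Q r.
  rewrite -gcd_a; elim/big_rec: _ r => [r|i x _ IHx]; first by rewrite addn0.
  exact: period_gcd (period_a i) IHx.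
have const r : residue_sum q Q r = residue_sum q Q 0.
  by elim: r => // r IHr; rewrite -addn1 period1.
(* One vanishing residue sum would make all of them vanish, hence also Q.[1]. *)
have res_neq0 r : residue_sum q Q r != 0.
  apply: contraNneq Q1 => r0; rewrite (horner1_residues _ q_gt0) big1 // => i _.
  by rewrite const -(const r).
rewrite (weight_sections _ q_gt0) nE mulnC -{1}[q]card_ord -sum_nat_const.
apply: leq_sum => r _; rewrite section_comp_mul // -mulrA.
apply: leq_trans (weight_multiplicity _ _).
  rewrite leq_exp2l // digit_sum_mul_Mersenne // /e.
  by rewrite (bigD1 (Ordinal k_gt0)) //= addn_gt0 expn_gt0.
rewrite hornerM mulf_neq0 //.
by have := res_neq0 r; rewrite /residue_sum modn_small.
Qed.

Lemma weight_geo_prod k (a : 'I_k -> nat) n :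
  (0 < n)%N -> (0 < k)%N -> (forall i, 0 < a i)%N ->
  (n <= weight (geo_prod a n : {poly R}))%N.
Proof.
move=> n_gt0 k_gt0 a_gt0; set d := (\big[gcdn/0%N]_(i < k) a i)%N.
have d_dvd i : (d %| a i)%N.
  by rewrite /d (bigD1 i) //= dvdn_gcdl.
have d_gt0 : (0 < d)%N := dvdn_gt0 (a_gt0 (Ordinal k_gt0)) (d_dvd _).
have aE i : a i = (d * (a i %/ d))%N by rewrite mulnC divnK.
have -> : geo_prod a n =
    geo_prod (fun i => a i %/ d)%N n \Po 'X^d :> {poly R}.
  rewrite rmorph_prod; apply: eq_bigr => i _ /=.
  by rewrite rmorphM rmorphXn /= comp_polyX geo_comp_Xn -exprM -aE.
apply: leq_trans (weight_comp_Xn _ d_gt0); apply: weight_geo_prod_coprime => //.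
  by move=> i; rewrite divn_gt0 // dvdn_leq.
apply/eqP; rewrite -(eqn_pmul2l d_gt0) muln1 big_distrr /=.
by under eq_bigr do rewrite -aE.
Qed.

End CharTwo.

(** * Finite sets of integers as polynomials modulo 2 *)

Section Support.

Implicit Types p q : {poly 'F_2}.

Definition support p : {fset int} :=
  [fset i%:Z | i in [seq i <- iota 0 (size p) | p`_i != 0]]%fset.

Lemma mem_support p m :
  (m \in support p) = if m is Posz i then p`_i != 0 else false.
Proof.
apply/imfsetP/idP => /= [[i]|].
  by rewrite mem_filter => /andP[pi _] ->.
case: m => // i pi; exists i => //; rewrite mem_filter pi mem_iota /=.
by rewrite ltnNge; apply: contra pi => le_pi; rewrite nth_default.
Qed.

Lemma enum_support p :
  perm_eq (support p) [seq i%:Z | i <- iota 0 (size p) & p`_i != 0].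
Proof.
apply: uniq_perm => [||m]; first exact: fset_uniq.
  by rewrite map_inj_uniq ?filter_uniq ?iota_uniq // => i j [].
by apply/imfsetP/mapP.
Qed.

Lemma card_support p : #|` support p| = weight p.
Proof.
rewrite (perm_size (enum_support p)) size_map size_filter -sum1_count.
rewrite big_mkcond /= /weight.
rewrite -(big_mkord xpredT (fun i => nat_of_bool (p`_i != 0))).
by rewrite /index_iota subn0; apply: eq_bigr => i _; case: eqP.
Qed.

Lemma nonzero_F2D : {morph (fun x : 'F_2 => x != 0) : x y / x + y >-> addb x y}.
Proof. by move=> [[|[|]] // ?] [[|[|]] // ?]. Qed.

(** Being nonzero turns sums in the field with two elements into exclusive
    disjunctions, so the coefficient formula of a product becomes the parity
    that defines membership in [oddsum]. *)
Lemma oddsum_support p q : oddsum (support p) (support q) = support (p * q).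
Proof.
apply/fsetP => m; rewrite mem_oddsumE (perm_big _ (enum_support p)) /=.
rewrite big_map big_filter mem_support; case: m => m; last first.
  by apply: big1 => i _; rewrite mem_support NegzE -opprD.
rewrite coefM (big_morph _ nonzero_F2D (_ : _ = false)) //.
rewrite -(big_mkord xpredT (fun i => p`_i * q`_(m - i) != 0)) big_mkcond /=.
(* The two sums run over i < size p and over i <= m; both are sums of F over
   any longer range. *)
pose F i := [&& p`_i != 0, (i <= m)%N & q`_(m - i) != 0].
transitivity (\big[addb/false]_(0 <= i < size p) F i).
  rewrite /index_iota subn0; apply: eq_bigr => i _; rewrite mem_support /F.
  case: (p`_i =P 0) => //= _; case: leqP => [le_im|lt_mi].
    by rewrite subzn.
  by case E: (m%:Z - i%:Z) => [j|//]; lia.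
transitivity (\big[addb/false]_(0 <= i < maxn (size p) m.+1) F i).
  rewrite [RHS](@big_cat_nat _ _ _ (size p)) ?leq_maxl //=.
  rewrite [X in _ = addb _ X]big_nat.
  rewrite [X in _ = addb _ X]big1 ?addbF // => i /andP[le_pi _].
  by rewrite /F nth_default // eqxx.
rewrite (@big_cat_nat _ _ _ m.+1) ?leq_maxr //= [X in addb _ X]big_nat.
rewrite [X in addb _ X]big1 ?addbF => [|i /andP[lt_mi _]]; last first.
  by rewrite /F leqNgt lt_mi andbF.
rewrite big_nat [RHS]big_nat; apply: eq_bigr => i lt_im.
by rewrite /F mulf_eq0 negb_or; have -> : (i <= m)%N by lia.
Qed.

Lemma support1 : support 1 = [fset 0]%fset.
Proof.
apply/fsetP => m; rewrite mem_support inE; case: m => // m.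
by rewrite coef1; case: m.
Qed.

Lemma support_multiples n a : (0 < a)%N ->
  support ('X^a * geo n a) = multiples n a%:Z.
Proof.
move=> a_gt0; apply/fsetP => m; rewrite mem_support.
have -> : 'X^a * geo n a = \sum_(j < n) 'X^(j.+1 * a) :> {poly 'F_2}.
  by rewrite /geo big_distrr /=; apply: eq_bigr => j _; rewrite -exprD mulSn.
apply/idP/imfsetP => /= [|[j]].
  case: m => // m coef_m.
  have [/existsP[j /eqP mE]|no_j] := boolP [exists j : 'I_n, m == (j.+1 * a)%N].
    by exists j.+1; rewrite ?mem_iota ?add1n ?ltnS /= ?mE ?PoszM.
  case/eqP: coef_m; rewrite coef_sum big1 // => j _; rewrite coefXn.
  by case: eqP => // mE; case/existsP: no_j; exists j; rewrite mE.
rewrite mem_iota add1n ltnS => /andP[]; case: j => // j _ lt_jn ->.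
rewrite -PoszM coef_sum (bigD1 (Ordinal lt_jn)) //= coefXn eqxx big1 ?addr0 //.
move=> i; rewrite -val_eqE /= => ne_ij; rewrite coefXn eqn_pmul2r // eqSS.
by rewrite eq_sym (negbTE ne_ij).
Qed.

End Support.

Theorem theorem1p3 (n k : nat) (a : 'I_k -> int)
    (n_gt0 : (0 < n)%N) (k_gt0 : (0 < k)%N) (a_gt0 : forall i : 'I_k, (0 < a i)%R) :
  (n <= #|` \big[oddsum/[fset 0%R]%fset]_(i < k) multiples n (a i)|)%N.
Proof.
have aE i : a i = `|a i|%N%:Z by rewrite gtz0_abs.
have absa_gt0 i : (0 < `|a i|)%N by rewrite absz_gt0 gt_eqF.
suff -> : \big[oddsum/[fset 0%R]%fset]_(i < k) multiples n (a i) =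
    support (geo_prod (fun i => `|a i|%N) n).
  by rewrite card_support weight_geo_prod // pchar_Fp.
rewrite /geo_prod.
rewrite (big_morph support (fun p q => esym (oddsum_support p q)) support1).
by apply: eq_bigr => i _; rewrite support_multiples // -aE.
Qed.
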